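(* Let $X_1,\dots,X_n$ be independent and identically distributed random variables with absolutely continuous distribution function $F$, with order statistics $X_{1:n}\le\cdots\le X_{n:n}$. Let $1\le k<r\le n$, and let $N_{r:n}(k)$ be the number of inspections needed to detect $k$ failed components, i.e. $$N_{r:n}(k)=\min\left\{m\ge1:\ \#\{i\in\{1,\dots,m\}: X_i<X_{r:n}\}=k\right\}.$$ Then for $m=k,k+1,\dots,n-r+k+1$, $$P\{N_{r:n}(k)=m\}=\binom{m-1}{k-1}\sum_{j=0}^{m-k}(-1)^j\binom{m-k}{j}\frac{(n-k-j)!\,(r-1)!}{n!\,(r-k-j-1)!}.$$
   Context: $X_1,\dots,X_n$ are the lifetimes of components $A_1,\dots,A_n$ of an $(n-r+1)$-out-of-$n$ system, whose lifetime is $X_{r:n}$, the $r$th smallest of the $X_i$. Components are inspected one at a time in the order $A_1,A_2,\dots$; component $A_i$ is found failed if $X_i<X_{r:n}$ and alive otherwise. $N_{r:n}(k)$ is the index of the inspection at which the $k$th failed component is found. Terms of the sum with $r-k-j-1<0$ are taken to be $0$ (convention $1/(-\ell)!=0$ for integers $\ell\ge1$). *)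

(* Defs.v *)
From mathcomp Require Export all_boot all_order all_algebra.
From mathcomp Require Export all_classical all_reals all_analysis.

Set Implicit Arguments.
Unset Strict Implicit.
Unset Printing Implicit Defensive.

Import Order.TTheory GRing.Theory Num.Theory.

Local Open Scope classical_set_scope.
Local Open Scope ring_scope.

Definition mutually_independent d (T : measurableType d) (R : realType)
    (P : probability T R) (I : finType) (X : I -> {RV P >-> R}) : Prop :=
  forall (J : {set I}) (B : I -> set R),
    (forall i, i \in J -> measurable (B i)) ->
    P (\bigcap_(i in [set` J]) (X i @^-1` B i))
    = (\prod_(i in J) P (X i @^-1` B i))%E.

Definition identically_distributed d (T : measurableType d) (R : realType)
    (P : probability T R) (I : Type) (X : I -> {RV P >-> R}) : Prop :=
  forall (i j : I) (B : set R), measurable B ->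
    distribution P (X i) B = distribution P (X j) B.

(* The intervals ]a i, b i[ of the finite family are pairwise disjoint; as the
   family is indexed by 'I_N they may come in any order. *)
Definition absolutely_continuous (R : realType) (F : R -> R) : Prop :=
  forall e : R, 0 < e -> exists2 delta : R, 0 < delta &
    forall (N : nat) (a b : 'I_N -> R),
      (forall i, a i <= b i) ->
      trivIset [set: 'I_N] (fun i => `]a i, b i[%classic) ->
      \sum_(i < N) (b i - a i) < delta ->
      \sum_(i < N) `|F (b i) - F (a i)| < e.

(* [order_statistic x r] is the r-th smallest of the x i counted with
   multiplicity, r ranging from 1 to n (junk value outside that range). *)
Definition order_statistic (R : realType) (n : nat) (x : 'I_n -> R) (r : nat)
    : R :=
  nth 0 (sort <=%O [seq x i | i : 'I_n]) r.-1.

(* Component A_i is the ordinal i - 1, so the first m components are the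
   ordinals i < m. *)
Definition failed_among_first (R : realType) (n r : nat) (x : 'I_n -> R)
    (m : nat) : nat :=
  #|[pred i : 'I_n | (i < m)%N && (x i < order_statistic x r)]|.

(* The value is None when there are fewer than k failed components, which for
   k < r requires a tie among the lifetimes. *)
Definition inspections (R : realType) (n r k : nat) (x : 'I_n -> R)
    : option nat :=
  match pselect (exists m,
      (1 <= m)%N && (failed_among_first r x m == k)) with
  | left ex => Some (ex_minn ex)
  | right _ => None
  end.

(* 1 / z!, with the convention 1 / (- l)! = 0 for l >= 1. *)
Definition inv_fact (R : realType) (z : int) : R :=
  match z with
  | Posz l => (l`!%:R)^-1
  | Negz _ => 0
  end.

(* Main.v *)
Require Import Defs.
From mathcomp Require Import fingroup perm measurable_realfun zify ring lra.

Set Implicit Arguments.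
Unset Strict Implicit.
Unset Printing Implicit Defensive.

Import Order.TTheory GRing.Theory Num.Theory.
Local Open Scope classical_set_scope.
Local Open Scope ring_scope.

(** The number of inspections depends on the lifetimes only through the set S
    of failed components, and S is a uniformly random set of r - 1 components.

    Size of S.  Since F is continuous, two independent lifetimes are almost
    surely distinct ([tie_null]): cut the line into countably many cells of
    F-mass at most e; a tie forces both lifetimes into one cell, which has
    probability at most the sum of the squared masses, hence at most e.
    Without ties exactly r - 1 lifetimes are below the r-th smallest
    ([card_failed_set]).

    Uniformity of S.  The joint law of independent, identically distributed
    variables is invariant under permutations of the indices, because it is so
    on boxes, which generate the product sigma-algebra and are stable under
    intersection ([exchangeable]).  Permuting the lifetimes permutes S
    ([failed_set_perm]), and any two index sets of equal size are exchanged by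
    some permutation, so all sets of size r - 1 are equally likely
    ([probability_uniform]).

    Counting.  The k-th failure is found at inspection m exactly when component
    m belongs to S and k - 1 of the first m - 1 components do
    ([inspectionsP]).  Of the 'C(n, r - 1) sets of size r - 1, this holds for
    'C(m - 1, k - 1) * 'C(n - m, r - 1 - k) of them ([card_split_sets]).  The
    alternating sum of the theorem is 'C(n - m, r - 1 - k) / 'C(n, r - 1)
    written by inclusion and exclusion: 'C(N - a, s) counts the s-subsets of N
    points that avoid a given ones, and 'C(N - j, s - j) those that contain j
    given ones ([alternating_sum_bin]). *)

(** * Failed components and ranks *)

(** In the sorted list the values at most y form an initial segment, so the
    entry of index r - 1 exceeds y precisely when that segment stops before it. *)
Lemma lt_order_statistic (R : realType) (n r : nat) (x : 'I_n -> R) (y : R) :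
  (1 <= r <= n)%N ->
  (y < order_statistic x r) = (#|[pred j | (x j <= y)%R]| < r)%N.
Proof.
move=> /andP[r_ge1 r_le_n]; rewrite /order_statistic.
set s := [seq x i | i : 'I_n].
have sz : size (sort <=%O s) = n by rewrite size_sort size_image card_ord.
have cnt : count (<= y) (sort <=%O s) = #|[pred j | x j <= y]|.
  by rewrite count_sort -sum1_count big_map big_enum_cond sum1_card.
rewrite -cnt; apply/idP/idP.
  apply: contraLR; rewrite -leqNgt -leNgt => c_ge.
  by apply: nth_count_le; [exact: sort_le_sorted|rewrite prednK].
move=> c_lt; apply: nth_count_gt; first exact: sort_le_sorted.
rewrite sz; case: (r) r_ge1 r_le_n c_lt => // r' _ rn c_lt.
by rewrite rn andbT; exact: c_lt.
Qed.

Definition failed_set (R : realType) (n r : nat) (x : 'I_n -> R) : {set 'I_n} :=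
  [set i | x i < order_statistic x r]%SET.

(** Ranks are defined by comparisons between lifetimes alone, which makes both
    the symmetry and the measurability of the failed set accessible. *)
Lemma failed_set_rank (R : realType) (n r : nat) (x : 'I_n -> R) :
  (1 <= r <= n)%N ->
  failed_set r x = [set i | (#|[pred j | (x j <= x i)%R]| < r)%N]%SET.
Proof. by move=> rn; apply/setP => i; rewrite !inE lt_order_statistic. Qed.

Lemma failed_set_perm (R : realType) (n r : nat) (x : 'I_n -> R)
    (s : 'S_n) : (1 <= r <= n)%N ->
  failed_set r (x \o s) = s @^-1: failed_set r x.
Proof.
move=> rn; rewrite !failed_set_rank //; apply/setP => i; rewrite !inE.
by rewrite -!sum1_card [in RHS](reindex_inj (@perm_inj _ s)).
Qed.

Lemma card_lt_rank (n r : nat) (f : 'I_n -> 'I_n) : injective f ->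
  (r <= n)%N -> #|[set i | (f i < r)%N]%SET| = r.
Proof.
move=> f_inj rn.
rewrite -[RHS]card_ord -(card_imset _ (f := widen_ord rn)); last first.
  by move=> a b /(congr1 val) /= ab; apply: val_inj.
rewrite -(card_imset _ f_inj); apply: eq_card => i.
apply/imsetP/imsetP => [[j]|[j _ ->]].
  by rewrite inE => fjr ->; exists (Ordinal fjr) => //; apply: val_inj.
have [g fg gf] := injF_bij f_inj.
exists (g (widen_ord rn j)); last by rewrite gf.
by rewrite inE gf /=.
Qed.

(** Without ties, counting the strictly smaller lifetimes is an injection of the
    n indices into {0, ..., n - 1}, hence a bijection, and the failed components
    are the preimage of its first r - 1 values. *)
Lemma card_failed_set (R : realType) (n r : nat) (x : 'I_n -> R) :
  (1 <= r <= n)%N -> injective x -> #|failed_set r x| = r.-1.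
Proof.
move=> rn x_inj; rewrite failed_set_rank //.
have rankS i : #|[pred j | x j <= x i]| = #|[pred j | x j < x i]|.+1.
  rewrite (cardD1 i) inE lexx add1n; congr _.+1; apply: eq_card => j.
  by rewrite !inE lt_neqAle (inj_eq x_inj).
have rank_lt i : (#|[pred j | (x j < x i)%R]| < n)%N.
  by rewrite -rankS -[leqRHS]card_ord max_card.
have rank_inj : injective (fun i => Ordinal (rank_lt i)).
  suff mono i j : x i < x j ->
      (#|[pred k | (x k < x i)%R]| < #|[pred k | (x k < x j)%R]|)%N.
    move=> i j /(congr1 val) /= e; apply: x_inj.
    by have [/mono|/mono|//] := ltgtP (x i) (x j); rewrite e ltnn.
  move=> ij; apply: proper_card; apply/properP; split.
    by apply/fintype.subsetP => k; rewrite !inE => /lt_trans; apply.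
  by exists i; rewrite !inE ?ltxx.
rewrite -[RHS](card_lt_rank rank_inj); last lia.
by apply: eq_card => i; rewrite !inE rankS /=; lia.
Qed.

(** * The inspection number as a function of the failed set *)

Lemma failed_among_firstE (R : realType) (n r : nat) (x : 'I_n -> R) m :
  failed_among_first r x m = #|failed_set r x :&: [set i : 'I_n | (i < m)%N]%SET|.
Proof. by apply: eq_card => i; rewrite !inE andbC. Qed.

(** The count of failures among the first m components starts at 0 and at each
    inspection stays or grows by one, so its first passage at k is a step from
    k - 1 to k, and such a step occurs only once. *)
Lemma inspectionsP (R : realType) (n r k : nat) (x : 'I_n -> R) (o : 'I_n) :
  (1 <= k)%N ->
  inspections r k x = Some o.+1 <->
  o \in failed_set r x /\
  #|failed_set r x :&: [set i : 'I_n | (i < o)%N]%SET| = k.-1.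
Proof.
move=> k_ge1; set A := failed_set r x.
pose c m := #|A :&: [set i : 'I_n | (i < m)%N]%SET|.
have cE m : failed_among_first r x m = c m by exact: failed_among_firstE.
have c0 : c 0 = 0%N.
  by apply/eqP; rewrite cards_eq0; apply/eqP/setP => i; rewrite !inE ltn0 andbF.
have cS : c o.+1 = ((o \in A) + c o)%N.
  rewrite /c (cardsD1 o) !inE ltnSn andbT; congr (_ + _)%N.
  by apply: eq_card => i; rewrite !inE ltnS [RHS]andbC (ltn_neqAle i) -andbA
    [(i <= o)%N && _]andbC.
have c_mono a b : (a <= b)%N -> (c a <= c b)%N.
  move=> ab; apply: subset_leq_card; apply: finset.setIS; apply/fintype.subsetP => i.
  by rewrite !inE => /leq_trans; apply.
rewrite -/(c o) /inspections; case: pselect => [ex|nex]; last first.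
  split=> // -[oA co]; case: nex; exists o.+1; rewrite cE cS oA co; lia.
case: ex_minnP => m /andP[m_ge1 /eqP cm] m_min; rewrite cE in cm; split.
  move=> [mo]; subst m; have : c o <> k.
    case: (posnP o) => [->|o_gt0]; first by rewrite c0; lia.
    by move=> co; have := m_min o; rewrite cE co eqxx o_gt0 ltnn => /(_ isT).
  by move: cm; rewrite cS; case: (o \in A) => /=; lia.
move=> [oA co]; congr Some; apply/eqP; rewrite eqn_leq.
rewrite m_min ?cE ?cS ?oA ?co /=; last by lia.
by rewrite ltnNge; apply/negP => /c_mono; rewrite cm co; lia.
Qed.

(** Such a set consists of o together with an arbitrary l-subset of the indices
    below o and an arbitrary s-subset of the indices above o. *)
Lemma card_split_sets (n s l : nat) (o : 'I_n) :
  #|[set A : {set 'I_n} | [&& #|A| == (l + s).+1, o \in A &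
       #|A :&: [set i : 'I_n | (i < o)%N]%SET| == l]]%SET| =
  ('C(o, l) * 'C(n - o.+1, s))%N.
Proof.
pose L := [set i : 'I_n | (i < o)%N]%SET; pose H := [set i : 'I_n | (o < i)%N]%SET.
have cL : #|L| = o.
  by apply: (@card_lt_rank n o id) => //; exact: ltnW.
have HE : H = ~: (o |: L).
  by apply/setP => i; rewrite !inE -val_eqE /=; lia.
have cH : #|H| = (n - o.+1)%N.
  by rewrite HE cardsCs finset.setCK cardsU1 cL !inE ltnn card_ord.
pose DL := [set B : {set 'I_n} | B \subset L & #|B| == l]%SET.
pose DH := [set B : {set 'I_n} | B \subset H & #|B| == s]%SET.
have <- : #|finset.setX DL DH| = ('C(o, l) * 'C(n - o.+1, s))%N.
  by rewrite cardsX !cards_draws cL cH.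
pose f (BC : {set 'I_n} * {set 'I_n}) := o |: (BC.1 :|: BC.2).
have fL (B C : {set 'I_n}) : B \subset L -> C \subset H -> f (B, C) :&: L = B.
  move=> /fintype.subsetP BL /fintype.subsetP CH; apply/setP => i; rewrite !inE.
  apply/idP/idP => [/andP[/or3P[/eqP->|//|/CH]]|iB].
  - by rewrite ltnn.
  - by rewrite inE; lia.
  - by have := BL _ iB; rewrite inE iB orbT.
have fH (B C : {set 'I_n}) : B \subset L -> C \subset H -> f (B, C) :&: H = C.
  move=> /fintype.subsetP BL /fintype.subsetP CH; apply/setP => i; rewrite !inE.
  apply/idP/idP => [/andP[/or3P[/eqP->|/BL|//]]|iC].
  - by rewrite ltnn.
  - by rewrite inE; lia.
  - by have := CH _ iC; rewrite inE iC !orbT.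
have fE (A : {set 'I_n}) : o \in A -> A = f (A :&: L, A :&: H).
  move=> oA; apply/setP => i; rewrite !inE /=.
  case: (altP (i =P o)) => [->//|]; rewrite -val_eqE /=.
  by case: (i \in A) => //=; lia.
have fc (B C : {set 'I_n}) : B \subset L -> C \subset H ->
    #|f (B, C)| = (#|B| + #|C|).+1.
  move=> BL CH; rewrite cardsU1 finset.cardsU.
  have -> : B :&: C = finset.set0.
    apply/setP => i; rewrite !inE; apply/negP => /andP[].
    by move=> /(fintype.subsetP BL) + /(fintype.subsetP CH); rewrite !inE; lia.
  rewrite cards0 subn0 inE negb_or.
  have -> : o \notin B by apply/negP => /(fintype.subsetP BL); rewrite inE ltnn.
  have -> : o \notin C by apply/negP => /(fintype.subsetP CH); rewrite inE ltnn.
  by [].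
rewrite -(card_in_imset (f := f)); last first.
  move=> [B C] [B' C'] /finset.setXP[]; rewrite !inE /= => /andP[BL _] /andP[CH _].
  move=> /andP[/andP[BL' _] /andP[CH' _]] fBC; congr (_, _).
    by rewrite -(fL _ _ BL CH) fBC fL.
  by rewrite -(fH _ _ BL CH) fBC fH.
apply: eq_card => A; rewrite inE; apply/and3P/imsetP => [[cA oA cAL]|].
  exists (A :&: L, A :&: H); last exact: fE.
  rewrite !inE /= !finset.subsetIr /= cAL /=.
  have := fc _ _ (finset.subsetIr A L) (finset.subsetIr A H).
  by rewrite -fE // (eqP cA) (eqP cAL) => -[/eqP]; rewrite eqn_add2l eq_sym.
move=> [[B C] /finset.setXP[]]; rewrite !inE /= => /andP[BL /eqP cB] /andP[CH /eqP cC].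
by move=> ->; split; rewrite ?fc ?fL ?cB ?cC // !inE eqxx.
Qed.

(** Listing A and then its complement enumerates all indices; reading that list
    as a permutation carries the initial segment of length #|A| onto A. *)
Lemma exists_perm_initial (n : nat) (A : {set 'I_n}) :
  exists s : 'S_n, s @^-1: A = [set i : 'I_n | (i < #|A|)%N]%SET.
Proof.
pose e := enum A ++ enum (~: A).
have e_uniq : uniq e.
  rewrite cat_uniq !enum_uniq andbT /=.
  by apply/hasPn => i; rewrite !mem_enum inE.
have sz : size e = n.
  by rewrite size_cat -!cardE cardsC card_ord.
have nth_inj : injective (fun i : 'I_n => nth i e i).
  move=> i j; rewrite (set_nth_default j) ?sz //= => /eqP.
  by rewrite nth_uniq ?sz // => /eqP /val_inj.
exists (perm nth_inj); apply/setP => i; rewrite !inE permE nth_cat -cardE.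
case: ltnP => [iA|Ai]; first by rewrite -mem_enum mem_nth // -cardE.
apply/negP/negP; rewrite -finset.in_setC -mem_enum mem_nth // -cardE.
by rewrite ltn_subLR // cardsC card_ord ltn_ord.
Qed.

Lemma exists_perm_preimset (n : nat) (A B : {set 'I_n}) :
  #|A| = #|B| -> exists s : 'S_n, s @^-1: A = B.
Proof.
move=> AB; have [[u uA] [v vB]] := (exists_perm_initial A, exists_perm_initial B).
exists (v^-1 * u)%g; apply/setP => i; rewrite inE permM.
have /setP/(_ (v^-1 i)%g) := uA; by rewrite AB -vB !inE permKV => ->.
Qed.

(** * The alternating sum *)

(** Induction on a for all N and s: Pascal's rule on 'C(a.+1, j) splits the sum
    into the sum for (a, N, s) minus the sum for (a, N - 1, s - 1), and Pascal's
    rule on 'C(N - a, s) gives the same recursion on the right.  The test j <= s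
    is there because truncated subtraction would turn 'C(N - j, s - j) into 1
    for j > s. *)
Lemma alternating_sum_bin (R : ringType) (a N s : nat) : (a <= N)%N ->
  \sum_(0 <= j < a.+1) (-1) ^+ j * 'C(a, j)%:R *
     (if (j <= s)%N then 'C(N - j, s - j)%:R else 0) = 'C(N - a, s)%:R :> R.
Proof.
elim: a N s => [|a IHa] N s aN.
  by rewrite big_nat1 bin0 !mul1r !subn0.
pose t j : R := if (j <= s)%N then 'C(N - j, s - j)%:R else 0.
have split_sum : \sum_(0 <= j < a.+2) (-1) ^+ j * 'C(a.+1, j)%:R * t j =
    \sum_(0 <= j < a.+1) (-1) ^+ j * 'C(a, j)%:R * t j
    - \sum_(0 <= j < a.+1) (-1) ^+ j * 'C(a, j)%:R * t j.+1.
  rewrite big_nat_recl //= -sumrN.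
  under eq_bigr do rewrite binS natrD mulrDr mulrDl.
  rewrite big_split /= addrA; congr (_ + _).
    transitivity (\sum_(0 <= j < a.+2) (-1) ^+ j * 'C(a, j)%:R * t j).
      by rewrite [RHS]big_nat_recl //= !bin0.
    by rewrite big_nat_recr //= bin_small // mulr0 mul0r addr0.
  by apply: eq_bigr => j _; rewrite exprS !mulN1r !mulNr.
rewrite split_sum IHa; last exact: ltnW.
case: s @t {split_sum} => [|s] t.
  by rewrite big1 ?subr0 ?bin0 // => j _; rewrite mulr0.
case: N aN @t => [//|N] aN t.
rewrite [X in _ - X](_ : _ = 'C(N - a, s)%:R); last first.
  by rewrite -IHa //; apply: eq_bigr => j _; rewrite /t ltnS.
by rewrite subSn // binS natrD addrK.
Qed.

(** Each quotient of factorials is 'C(n - k - j, r - 1 - k - j) / 'C(n, r - 1),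
    both binomials having the same complementary factor (n - r + 1)!; the terms
    with a negative factorial argument are those for which j > r - 1 - k. *)
Lemma inspection_sumE (R : realType) (n r k m : nat) :
  (1 <= k)%N -> (k < r)%N -> (r <= n)%N -> (k <= m)%N ->
  (m <= n - r + k + 1)%N ->
  \sum_(0 <= j < (m - k).+1)
      (-1) ^+ j * 'C(m - k, j)%:R *
      ((n - k - j)`!%:R * (r - 1)`!%:R / n`!%:R *
        inv_fact R (r%:Z - k%:Z - j%:Z - 1)) =
  'C(n - m, r.-1 - k)%:R / 'C(n, r.-1)%:R :> R.
Proof.
move=> k_ge1 kr rn km m_le.
have -> : (n - m = (n - k) - (m - k))%N by lia.
rewrite -(alternating_sum_bin _ (r.-1 - k)); last by lia.
rewrite mulr_suml; apply: eq_big_nat => j /andP[_ j_lt].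
rewrite -[RHS]mulrA; congr (_ * _).
have fact_neq0 (i : nat) : i`!%:R != 0 :> R by rewrite pnatr_eq0 -lt0n fact_gt0.
have C_neq0 : 'C(n, r.-1)%:R != 0 :> R by rewrite pnatr_eq0 -lt0n bin_gt0; lia.
case: leqP => [j_le|j_gt]; last first.
  have -> : r%:Z - k%:Z - j%:Z - 1 = Negz (j - (r.-1 - k)).-1 by lia.
  by rewrite mulr0 mul0r.
have -> : r%:Z - k%:Z - j%:Z - 1 = Posz (r.-1 - k - j) by lia.
rewrite /= subn1.
have e1 : 'C(n, r.-1)%:R * (r.-1`!%:R * (n - r.-1)`!%:R) = n`!%:R :> R.
  by rewrite -!natrM bin_fact //; lia.
have e2 : 'C(n - k - j, r.-1 - k - j)%:R *
    ((r.-1 - k - j)`!%:R * (n - r.-1)`!%:R) = (n - k - j)`!%:R :> R.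
  have -> : (n - r.-1 = n - k - j - (r.-1 - k - j))%N by lia.
  by rewrite -!natrM bin_fact //; lia.
rewrite -e1 -e2; field.
by rewrite C_neq0 !fact_neq0.
Qed.

(** * Product sigma-algebra and exchangeability *)

(** For a finite I these sets generate the product sigma-algebra on [I -> V]. *)
Definition boxes (I : Type) d (V : measurableType d) : set (set (I -> V)) :=
  [set [set x | forall i, B i (x i)] | B in
    [set B : I -> set V | forall i, measurable (B i)]].
Arguments boxes I {d} V.

Notation measurable_prod I V := (g_sigma_algebraType (boxes I V)).

Lemma setI_closed_boxes (I : Type) d (V : measurableType d) :
  setI_closed (boxes I V).
Proof.
move=> _ _ [A mA <-] [B mB <-]; exists (fun i => A i `&` B i) => [i /=|].
  exact: measurableI.
by apply/seteqP; split=> [x AB|x [xA xB] i]; [split=> i; case: (AB i)|split].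
Qed.

Lemma measurable_coord (I : choiceType) d (V : measurableType d) (i : I) :
  measurable_fun [set: measurable_prod I V] (fun x => x i).
Proof.
move=> _ B mB; rewrite setTI; apply: sub_sigma_algebra.
exists (fun j => if j == i then B else setT) => [j /=|].
  by case: ifP.
apply/seteqP; split=> [x /(_ i)|x xB j /=]; first by rewrite eqxx.
by case: eqP => [->|].
Qed.

Lemma measurable_joint d (T : measurableType d) (I : finType)
    d' (V : measurableType d') (X : I -> T -> V) :
  (forall i, measurable_fun setT (X i)) ->
  measurable_fun setT ((fun w i => X i w) : T -> measurable_prod I V).
Proof.
move=> mX.
apply: (@measurability _ _ T (measurable_prod I V) setT _ (boxes I V)) => //.
move=> _ [_ [B mB <-] <-].
rewrite setTI [X in measurable X](_ : _ = \bigcap_(i in [set: I]) (X i @^-1` B i)).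
  apply: fin_bigcap_measurable => // i _.
  by rewrite -[X in measurable X]setTI; exact: mX.
by apply/seteqP; split=> [w wB i _|w wB i]; [exact: wB|exact: (wB i)].
Qed.

(** On a box the two laws are products of the same factors in different order:
    independence factors the probability, and identical distribution lets each
    factor be moved to another index. *)
Lemma exchangeable d (T : measurableType d) (R : realType)
    (P : probability T R) (I : finType) (X : I -> {RV P >-> R})
    (s : {perm I}) (E : set (I -> R)) :
  mutually_independent X -> identically_distributed X ->
  (measurable : set (set (measurable_prod I R))) E ->
  P [set w | E (fun i => X (s i) w)] = P [set w | E (fun i => X i w)].
Proof.
move=> X_indep X_ident mE.
have mX : measurable_fun setT ((fun w i => X i w) : T -> measurable_prod I R).
  exact: measurable_joint.
have mXs : measurable_fun setT
    ((fun w i => X (s i) w) : T -> measurable_prod I R).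
  exact: measurable_joint.
pose mfX : {mfun T >-> measurable_prod I R} := mfun_Sub (mem_set mX).
pose mfXs : {mfun T >-> measurable_prod I R} := mfun_Sub (mem_set mXs).
change (distribution P mfXs E = distribution P mfX E).
apply: (@measure_unique _ R (measurable_prod I R) (boxes I R) (fun=> setT)) => //.
- exact: setI_closed_boxes.
- by move=> _; exists (fun=> setT) => //; apply/seteqP.
- by apply/seteqP; split => // x _; exists 0%N.
- move=> _ [B mB <-].
  have indep_box (C : I -> set R) : (forall i, measurable (C i)) ->
      P [set w | forall i, C i (X i w)] = (\prod_i P (X i @^-1` C i))%E.
    move=> mC; have := X_indep [set: I]%SET C (fun i _ => mC i).
    rewrite [X in P X = _ -> _](_ : _ = [set w | forall i, C i (X i w)]).
      by move=> ->; apply: eq_bigl => i; rewrite inE.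
    apply/seteqP; split=> [w wC i|w wC i _]; last exact: wC.
    by apply: (wC i); rewrite /= inE.
  rewrite /= /distribution /pushforward /=.
  (* The permuted box is again a box for the original family, with its sides
     reindexed by the inverse permutation. *)
  transitivity (P [set w | forall i, B ((s^-1)%g i) (X i w)]).
    congr (P _); apply/seteqP; split=> w wB i.
      by have := wB ((s^-1)%g i); rewrite permKV.
    by have := wB (s i); rewrite permK.
  rewrite (indep_box (fun i => B ((s^-1)%g i))) // indep_box //.
  rewrite (reindex_inj (@perm_inj _ s)) /=.
  apply: eq_bigr => i _; rewrite permK.
  exact: (X_ident (s i) i).
- by move=> _; rewrite /= /distribution /pushforward /= preimage_setT
     probability_setT ltry.
Qed.

(** * Ties between lifetimes *)

(** Families of one interval already give uniform continuity of F, which makes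
    the masses of all cells of a fine regular grid small at once. *)
Lemma absolutely_continuous_increment (R : realType) (F : R -> R) :
  absolutely_continuous F -> forall e : R, 0 < e -> exists2 delta, 0 < delta &
    forall a b, a <= b -> b - a < delta -> F b - F a < e.
Proof.
move=> F_ac e /F_ac[delta delta_gt0 Fd]; exists delta => // a b ab abd.
have := Fd 1%N (fun=> a) (fun=> b).
rewrite !big_ord1 => /(_ (fun=> ab) _ abd) FF.
apply: le_lt_trans (ler_norm _) (FF _).
by apply/trivIsetP => i j _ _; rewrite !ord1 eqxx.
Qed.

Lemma cdf_increment d (T : measurableType d) (R : realType)
    (P : probability T R) (X : {RV P >-> R}) (F : R -> R) (a b : R) :
  (forall x, cdf X x = (F x)%:E) -> a <= b ->
  P (X @^-1` `]a, b]) = (F b - F a)%:E.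
Proof.
move=> XF ab.
have mX (B : set R) : measurable B -> measurable (X @^-1` B).
  by move=> mB; rewrite -[X in measurable X]setTI; exact: measurable_funP.
have split_b : X @^-1` `]-oo, b] = X @^-1` `]-oo, a] `|` X @^-1` `]a, b].
  apply/seteqP; split=> w /=; rewrite !in_itv /=.
    by move=> wb; case: (leP (X w) a) => wa; [left|right].
  by case=> [wa|/andP[]//]; exact: le_trans ab.
have addb : P (X @^-1` `]-oo, b]) = (P (X @^-1` `]-oo, a]) + P (X @^-1` `]a, b]))%E.
  rewrite split_b; apply: measureU; [exact: mX|exact: mX|].
  apply/seteqP; split=> // w /= []; rewrite !in_itv /= => wa /andP[aw _].
  by move: (lt_le_trans aw wa); rewrite ltxx.
have Fa : P (X @^-1` `]-oo, a]) = (F a)%:E := XF a.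
have Fb : P (X @^-1` `]-oo, b]) = (F b)%:E := XF b.
by rewrite EFinB -Fb addb Fa [((F a)%:E + _)%E]addeC addeK.
Qed.

Lemma measurable_tie d (T : measurableType d) (R : realType) (X Y : T -> R) :
  measurable_fun setT X -> measurable_fun setT Y ->
  measurable [set w | X w = Y w].
Proof.
move=> mX mY; rewrite -[X in measurable X]setTI.
have := measurable_fun_eqr mX mY.
move=> /(_ measurableT [set true] I).
congr (measurable (_ `&` _)); apply/seteqP; split=> w /=; first by move/eqP.
by move=> ->; rewrite eqxx.
Qed.

(** The cells are the intervals ](c - 1) h, c h] for c an integer.  With p_c
    and q_c the masses of cell c under the laws of X and Y, the tie has
    probability at most the sum of p_c q_c, which is at most the largest q_c
    since the p_c sum to 1.  That largest mass is made arbitrarily small by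
    refining the grid. *)
Lemma tie_null d (T : measurableType d) (R : realType)
    (P : probability T R) (X Y : {RV P >-> R}) (F : R -> R) :
  (forall B C : set R, measurable B -> measurable C ->
    P (X @^-1` B `&` Y @^-1` C) = (P (X @^-1` B) * P (Y @^-1` C))%E) ->
  (forall x, cdf Y x = (F x)%:E) -> absolutely_continuous F ->
  P [set w | X w = Y w] = 0%E.
Proof.
move=> XY_indep YF F_ac.
have mpre (Z : {RV P >-> R}) (B : set R) :
    measurable B -> measurable (Z @^-1` B).
  by move=> mB; rewrite -[X in measurable X]setTI; exact: measurable_funP.
apply/eqP; rewrite eq_le measure_ge0 andbT; apply/lee_addgt0Pr => e e_gt0.
rewrite add0e.
(* Half of the modulus, because increments are controlled strictly below it;
   cells closed on the right, so that the cdf gives their mass; the integers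
   are coded as naturals to index a countable sum. *)
have [h0 h0_gt0 Fh0] := absolutely_continuous_increment F_ac e_gt0.
pose h := h0 / 2; have h_gt0 : 0 < h by rewrite /h; lra.
pose cell n := [set y : R | pickle (Num.ceil (y / h)) = n].
have cellP n : cell n = set0 \/
    exists c : int, cell n = `](c - 1)%:~R * h, c%:~R * h]%classic.
  have [->|/set0P[y <-]] := eqVneq (cell n) set0; [by left|right].
  exists (Num.ceil (y / h)); apply/seteqP; split=> z; rewrite /cell /= in_itv /=.
    move=> /(pcan_inj pickleK) /eqP.
    by rewrite ceil_eq ltr_pdivlMr // ler_pdivrMr.
  move=> zc; congr pickle; apply/eqP.
  by rewrite ceil_eq ltr_pdivlMr // ler_pdivrMr.
have mcell n : measurable (cell n) by case: (cellP n) => [->//|[c ->]].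
have cell_le n : (P (Y @^-1` cell n) <= e%:E)%E.
  case: (cellP n) => [->|[c ->]]; first by rewrite preimage_set0 measure0 lee_fin ltW.
  have hE : c%:~R * h - (c - 1)%:~R * h = h by rewrite intrB; ring.
  have hle : (c - 1)%:~R * h <= c%:~R * h by rewrite -subr_ge0 hE ltW.
  rewrite (cdf_increment YF hle) lee_fin ltW // Fh0 // hE /h; lra.
have le_sum : (P [set w | X w = Y w] <=
    \sum_(n <oo) P (X @^-1` cell n `&` Y @^-1` cell n))%E.
  apply: measure_sigma_subadditive.
  - by move=> n; apply: measurableI; exact: mpre.
  - by apply: measurable_tie; exact: measurable_funP.
  move=> w /= XYw; exists (pickle (Num.ceil (X w / h))) => //.
  by split=> //; rewrite /cell /= -XYw.
apply: le_trans le_sum _.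
(* Factor each term and bound the factor of Y by e: the factors of X sum to at
   most 1. *)
under eq_eseriesr do rewrite XY_indep //.
apply: (@le_trans _ _ (\sum_(n <oo) (e%:E * P (X @^-1` cell n)))%E).
  apply: lee_nneseries => n *; first exact: mule_ge0.
  by rewrite muleC lee_wpmul2r.
rewrite nneseriesZl // -measure_semi_bigcup.
- rewrite -[leRHS]mule1 lee_wpmul2l ?lee_fin ?(ltW e_gt0) //.
  by apply: probability_le1; apply: bigcup_measurable => n _; exact: mpre.
- by move=> n; exact: mpre.
- apply/trivIsetP => i j _ _ /eqP ij; apply/seteqP; split=> // w [/= wi wj].
  by apply: ij; rewrite -wi -wj.
- by apply: bigcup_measurable => n _; exact: mpre.
Qed.

Lemma mutually_independent_pair d (T : measurableType d) (R : realType)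
    (P : probability T R) (I : finType) (X : I -> {RV P >-> R}) (i j : I)
    (B C : set R) :
  mutually_independent X -> i != j -> measurable B -> measurable C ->
  P (X i @^-1` B `&` X j @^-1` C) = (P (X i @^-1` B) * P (X j @^-1` C))%E.
Proof.
move=> X_indep ij mB mC.
pose A k := if k == i then B else C.
have mA k : measurable (A k) by rewrite /A; case: ifP.
have := X_indep [set i; j]%SET A (fun k _ => mA k).
rewrite big_setU1 ?inE //= big_set1 /A eqxx [j == i]eq_sym (negPf ij) => <-.
congr (P _); apply/seteqP; split=> w /=.
  move=> [wi wj] k /=; rewrite !inE => /orP[]/eqP->; first by rewrite eqxx.
  by rewrite [j == i]eq_sym (negPf ij).
move=> wA; split.
  by have := wA i; rewrite /= !inE eqxx => /(_ isT).
by have := wA j; rewrite /= !inE eqxx orbT [j == i]eq_sym (negPf ij) => /(_ isT).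
Qed.

(** The event is covered by the finitely many events of a tie between two given
    indices, each of them null. *)
Lemma ties_null d (T : measurableType d) (R : realType)
    (P : probability T R) (I : finType) (X : I -> {RV P >-> R}) (F : R -> R)
    (E : set T) :
  mutually_independent X -> (forall i x, cdf (X i) x = (F x)%:E) ->
  absolutely_continuous F -> measurable E ->
  (forall w, E w -> ~ injective (fun i => X i w)) -> P E = 0%E.
Proof.
move=> X_indep XF F_ac mE E_ties.
apply/eqP; rewrite eq_le measure_ge0 andbT.
pose tie (ij : I * I) : set T := [set w | ij.1 <> ij.2 /\ X ij.1 w = X ij.2 w].
have tieE ij : tie ij = if ij.1 == ij.2 then set0
    else [set w | X ij.1 w = X ij.2 w].
  by apply/seteqP; case: eqP => ij12; split=> w //=; case.
have mtie ij : measurable (tie ij).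
  rewrite tieE; case: ifP => // _.
  by apply: measurable_tie; exact: measurable_funP.
have P_tie ij : P (tie ij) = 0%E.
  rewrite tieE; case: eqP => [_|/eqP ij12]; first exact: measure0.
  apply: (tie_null _ (XF ij.2) F_ac) => B C mB mC.
  exact: mutually_independent_pair.
apply: (@le_trans _ _ (\sum_(ij \in [set: I * I]) P (tie ij))%E).
  apply: content_sub_fsum => //; first exact: finite_finset.
  move=> w /E_ties Xw.
  apply: contrapT => no_tie; apply: Xw => i j Xij; apply: contrapT => ij.
  by apply: no_tie; exists (i, j).
by rewrite fsbig1.
Qed.

(** * Distribution of the failed set *)

(** There are finitely many Boolean patterns, so an event that depends only on
    the pattern is a finite union of finite intersections. *)
Lemma measurable_patterns d (U : measurableType d) (J : finType)
    (b : J -> U -> bool) (Q : {ffun J -> bool} -> Prop) :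
  (forall j, measurable [set u | b j u]) ->
  measurable [set u | Q [ffun j => b j u]].
Proof.
move=> mb.
rewrite [X in measurable X](_ : _ =
  \bigcup_(p in Q) \bigcap_(j in [set: J]) [set u | b j u = p j]).
  apply: fin_bigcup_measurable => // p _.
  apply: fin_bigcap_measurable => // j _; case: (p j); first exact: mb.
  rewrite [X in measurable X](_ : _ = ~` [set u | b j u]).
    exact: measurableC.
  by apply/seteqP; split=> u /=; [move=> ->|move/negP/negbTE].
apply/seteqP; split=> u /=.
  by move=> Qu; exists [ffun j => b j u] => // j _ /=; rewrite ffunE.
move=> [p Qp up]; rewrite (_ : [ffun j => b j u] = p) //.
by apply/ffunP => j; rewrite ffunE; exact: up.
Qed.

Lemma measurable_failed_set (R : realType) (n r : nat) (A : {set 'I_n}) :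
  (1 <= r <= n)%N ->
  (measurable : set (set (measurable_prod 'I_n R)))
    [set x | failed_set r x = A].
Proof.
move=> rn.
pose Q (p : {ffun 'I_n * 'I_n -> bool}) :=
  [set i : 'I_n | (#|[pred j | p (j, i)]| < r)%N]%SET = A.
rewrite [X in measurable X](_ : _ = [set x : measurable_prod 'I_n R |
    Q [ffun ji : 'I_n * 'I_n => x ji.1 <= x ji.2]]).
  apply: measurable_patterns => -[j i] /=.
  rewrite -[X in measurable X]setTI.
  exact: (measurable_fun_ler (measurable_coord j) (measurable_coord i)).
apply/seteqP; rewrite /Q; split=> x /=; rewrite failed_set_rank // => <-;
  by apply/setP => i; rewrite !inE; congr (_ < r)%N; apply: eq_card => j;
     rewrite !inE ffunE.
Qed.

(** The common value of the point masses on D is 1 / #|D| because the total mass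
    is 1, which also excludes an empty D. *)
Lemma probability_uniform d (T : measurableType d) (R : realType)
    (P : probability T R) (I : finType) (g : T -> I) (D Q : {set I}) :
  (forall a, measurable [set w | g w = a]) ->
  (forall a, a \notin D -> P [set w | g w = a] = 0%E) ->
  (forall a b, a \in D -> b \in D ->
     P [set w | g w = a] = P [set w | g w = b]) ->
  P [set w | g w \in Q] = (#|Q :&: D|%:R / #|D|%:R)%:E.
Proof.
move=> mg g0 g_unif.
pose p a := fine (P [set w | g w = a]).
have pE a : P [set w | g w = a] = (p a)%:E by rewrite fineK // fin_num_measure.
have PS (S : {set I}) : P [set w | g w \in S] = (\sum_(a in S) p a)%:E.
  rewrite (_ : [set w | _] = \bigcup_(a in [set` S]) [set w | g w = a]).
    have -> : P (\bigcup_(a in [set` S]) [set w | g w = a]) =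
        (\sum_(a \in [set` S]) P [set w | g w = a])%E.
      by apply: measure_fin_bigcup => // a b _ _ [w [/= -> ->]].
    rewrite -(@bigfs _ _ _ I (index_enum I) (mem S)) ?index_enum_uniq //.
      by rewrite (eq_bigr _ (fun a _ => pE a)) sumEFin.
    by move=> a _; rewrite mem_index_enum.
  by apply/seteqP; split=> w /=; [exists (g w)|move=> [a aS ->]].
have p0 a : a \notin D -> p a = 0 by move=> /g0; rewrite /p => ->.
have sum_q (q : R) (S : {set I}) : (forall a, a \in D -> p a = q) ->
    \sum_(a in S) p a = #|S :&: D|%:R * q.
  move=> pq; rewrite (bigID (mem D)) /= addrC big1 ?add0r; last first.
    by move=> a /andP[_ /p0].
  rewrite mulr_natl -sumr_const; apply: eq_big => a; first by rewrite inE.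
  by move=> /andP[_ /pq].
have sum1 : \sum_(a in [set: I]%SET) p a = 1.
  apply: EFin_inj; rewrite -PS -(probability_setT P); congr (P _).
  by apply/seteqP; split=> // w _ /=; rewrite inE.
have [D0|[b bD]] := set_0Vmem D.
  move: sum1; rewrite (sum_q 0) ?mulr0 => [/eqP|a]; last by rewrite D0 inE.
  by rewrite eq_sym oner_eq0.
have pb a : a \in D -> p a = p b by move=> aD; rewrite /p (g_unif a b).
rewrite PS (sum_q _ _ pb); congr (_ * _)%:E.
move: sum1; rewrite (sum_q _ _ pb) finset.setTI => Db.
have D_neq0 : #|D|%:R != 0 :> R.
  by apply: contra_eq_neq Db => ->; rewrite mul0r eq_sym oner_eq0.
by apply: (mulfI D_neq0); rewrite Db divff.
Qed.

Theorem theorem5 (d : measure_display) (T : measurableType d) (R : realType)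
    (P : probability T R) (n r k : nat) (X : 'I_n -> {RV P >-> R})
    (F : R -> R)
    (X_indep : mutually_independent X)
    (X_ident : identically_distributed X)
    (X_cdf : forall (i : 'I_n) (x : R), cdf (X i) x = (F x)%:E)
    (F_ac : absolutely_continuous F)
    (k_ge1 : (1 <= k)%N) (k_lt_r : (k < r)%N) (r_le_n : (r <= n)%N)
    (m : nat) (m_ge : (k <= m)%N) (m_le : (m <= n - r + k + 1)%N) :
  P [set w : T | inspections r k (fun i : 'I_n => X i w) = Some m] =
  ('C(m - 1, k - 1)%:R *
    \sum_(0 <= j < (m - k).+1)
      (-1) ^+ j * 'C(m - k, j)%:R *
      ((n - k - j)`!%:R * (r - 1)`!%:R / n`!%:R *
        inv_fact R (r%:Z - k%:Z - j%:Z - 1)))%:E.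
Proof.
rewrite inspection_sumE //.
have rn : (1 <= r <= n)%N by lia.
(* Inspection m looks at the component of index m - 1. *)
have m_lt_n : (m.-1 < n)%N by lia.
pose o := Ordinal m_lt_n; have mE : m = o.+1 by rewrite /=; lia.
pose S w := failed_set r (fun i => X i w).
pose D := [set A : {set 'I_n} | #|A| == r.-1]%SET.
pose Q := [set A : {set 'I_n} | (o \in A) &&
  (#|A :&: [set i : 'I_n | (i < o)%N]%SET| == k.-1)]%SET.
rewrite (_ : [set w | _] = [set w | S w \in Q]); last first.
  apply/seteqP; split=> w /=; rewrite mE inE.
    by move=> /(inspectionsP _ _ _ k_ge1)[-> /eqP ->].
  by move=> /andP[oS /eqP co]; apply/inspectionsP.
have mS A : measurable [set w | S w = A].
  rewrite -[X in measurable X]setTI.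
  have mX : measurable_fun setT ((fun w i => X i w) : T -> measurable_prod 'I_n R).
    by apply: measurable_joint => i; exact: measurable_funP.
  exact: (mX measurableT _ (measurable_failed_set A rn)).
rewrite (@probability_uniform _ _ _ _ _ S D Q) //.
- congr _%:E.
  have -> : #|D| = 'C(n, r.-1) by rewrite card_draws card_ord.
  rewrite mulrA -natrM; congr (_%:R / _).
  have -> : (m - 1 = o)%N by rewrite /=; lia.
  rewrite subn1 [in (n - m)%N]mE -card_split_sets.
  have -> : ((k.-1 + (r.-1 - k)).+1 = r.-1)%N by lia.
  by apply: eq_card => A; rewrite !inE andbC.
- move=> A; rewrite inE => A_card.
  apply: (ties_null X_indep X_cdf F_ac) => // w SA X_inj.
  by move: A_card; rewrite -SA card_failed_set // eqxx.
- move=> A B; rewrite !inE => /eqP cA /eqP cB.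
  (* Permuting the lifetimes by s replaces the failed set S by s @^-1: S, which
     is B = s @^-1: A exactly when S = A. *)
  have [s sAB] := exists_perm_preimset (etrans cA (esym cB)).
  rewrite -(@exchangeable _ _ _ _ _ X s
    [set x | failed_set r x = B] X_indep X_ident); last first.
    exact: measurable_failed_set.
  congr (P _); apply/seteqP; split=> w /=.
    by rewrite -sAB => <-; rewrite -failed_set_perm.
  rewrite -[fun i => _]/((fun i => X i w) \o s) failed_set_perm // -sAB.
  by move=> /setP preS; apply/setP => i; have := preS ((s^-1)%g i);
     rewrite !inE permKV.
Qed.
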